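(* Let $$\mathfrak U=\Big\{E:[0,\infty)\to[0,\infty)\text{ measurable and locally integrable}\ :\ \int_0^xE(t)\,dt\le x\text{ for all }x\ge0\Big\}.$$ Then the polar of $\mathcal U_{00}^+$ is $\mathfrak U$, i.e. $\mathfrak U$ is exactly the set of all e-values for $\mathcal U_{00}^+$ (jumpless continuous monotonicity). Further, the polar of $\mathcal U_0^+$ is $\mathfrak U_1:=\{E\in\mathfrak U:E(0)\le1\}$, i.e. $\mathfrak U_1$ is exactly the set of all e-values for $\mathcal U_0^+$ (continuous monotonicity with a possible jump at $0$).
   Context: $\mathcal U_0^+$ is the set of probability measures on $[0,\infty)$ whose CDF is concave on $[0,\infty)$ (an atom at $0$ is allowed), and $\mathcal U_{00}^+=\{P\in\mathcal U_0^+:P(\{0\})=0\}$. For a set $\mathcal A$ of probability measures on $[0,\infty)$, the polar $\mathcal A^\circ$ is the set of measurable functions $E:[0,\infty)\to[0,\infty)$ with $\mathbb E_{X\sim P}[E(X)]\le1$ for all $P\in\mathcal A$; its elements are the e-values for $\mathcal A$. *)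

(* Defs.v *)
From HB Require Import structures.
From mathcomp Require Import all_boot all_order all_algebra.
From mathcomp Require Import all_classical all_reals all_analysis.

Set Implicit Arguments.
Unset Strict Implicit.
Unset Printing Implicit Defensive.

Import Order.TTheory GRing.Theory Num.Theory.
Import numFieldNormedType.Exports.

Local Open Scope classical_set_scope.
Local Open Scope ring_scope.

Definition halfline {R : realType} : set R := `[0%R, +oo[%classic.

(* A probability measure on [0, +oo) is encoded as a Borel probability measure
   on the real line that gives mass 1 to [0, +oo); a function on [0, +oo) is
   encoded as a function on the real line of which only the values on [0, +oo)
   are ever inspected. *)
Definition halfline_probability {R : realType} :
    set (probability (measurableTypeR R) R) :=
  [set P | P halfline = 1%E].

Definition dist_fun {R : realType} (P : probability (measurableTypeR R) R)
    (x : R) : R :=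
  fine (P `]-oo, x]%classic).

(* The library has convex functions only: concave means convex opposite. *)
Definition concave_function {R : realType} (D : set R) (f : R -> R) : Prop :=
  @convex_function R R^o D (fun x => - f x).

Definition U0plus {R : realType} : set (probability (measurableTypeR R) R) :=
  [set P | halfline_probability P /\ concave_function halfline (dist_fun P)].

Definition U00plus {R : realType} : set (probability (measurableTypeR R) R) :=
  [set P | U0plus P /\ P [set 0%R] = 0%E].

Definition nonneg_measurable {R : realType} (E : R -> R) : Prop :=
  measurable_fun halfline E /\ (forall x, halfline x -> 0 <= E x).

Definition polar {R : realType}
    (A : set (probability (measurableTypeR R) R)) : set (R -> R) :=
  [set E | nonneg_measurable E /\
           (forall P, A P -> (\int[P]_(x in halfline) (E x)%:E <= 1)%E)].

(* The library's locally_integrable asks for an open domain of the real line,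
   so it does not apply to [0, +oo); this is the same notion for the space
   [0, +oo) itself: finite integral over its compact subsets. *)
Definition halfline_locally_integrable {R : realType} (E : R -> R) : Prop :=
  measurable_fun halfline E /\
  (forall K : set R, K `<=` halfline -> compact K ->
     (\int[lebesgue_measure]_(x in K) `|E x|%:E < +oo)%E).

Definition frakU {R : realType} : set (R -> R) :=
  [set E | [/\ nonneg_measurable E, halfline_locally_integrable E &
    forall x : R, 0 <= x ->
      (\int[lebesgue_measure]_(t in `[0%R, x]) (E t)%:E <= x%:E)%E]].

Definition frakU1 {R : realType} : set (R -> R) :=
  [set E | frakU E /\ E 0 <= 1].

(* Main.v *)
(* Uniform laws on [0, x] belong to U00+ and the Dirac mass at 0 to U0+, which
   gives the necessary conditions.  Conversely a law P with concave CDF F has on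
   (0, oo) a nonincreasing density f, a one-sided slope of F.  The measure
   E dx gives (0, x] mass at most x, hence, integrating f by layers,
   int E f dx = int_0^oo (int_{f > s} E dx) ds <= int_0^oo |{f > s}| ds
   = P(0, oo), each {f > s} being an interval starting at 0. *)
Require Import Defs.
From mathcomp Require Import all_boot all_order all_algebra.
From mathcomp Require Import all_classical all_reals all_analysis.
From mathcomp Require Import measurable_realfun ring lra.

Import Order.TTheory GRing.Theory Num.Theory.
Import numFieldNormedType.Exports.

Local Open Scope classical_set_scope.
Local Open Scope ring_scope.

(** * Concave functions and their slopes *)

(** The point [y] is the convex combination of [x] and [z] with weight [(z - y) / (z - x)] on [x];
    multiplying concavity by [z - x] clears the denominator. *)
Lemma concave_slope (R : realType) (F : R -> R) (x y z : R) :
  concave_function halfline F -> 0 <= x -> x < y -> y < z ->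
  (F z - F y) * (y - x) <= (F y - F x) * (z - y).
Proof.
move=> cF x0 xy yz.
have zx : 0 < z - x by rewrite subr_gt0 (lt_trans xy).
have t0 : 0 <= (z - y) / (z - x) by rewrite divr_ge0 ?subr_ge0 ?ltW // (lt_trans xy).
have t1 : (z - y) / (z - x) <= 1 by rewrite ler_pdivrMr // mul1r; lra.
have Dx : x \in (halfline : set R) by rewrite inE /halfline /= in_itv/= x0.
have Dz : z \in (halfline : set R).
  by rewrite inE /halfline /= in_itv/= andbT; lra.
pose t := (z - y) / (z - x).
have h : - F (t * x + (1 - t) * z) <= t * - F x + (1 - t) * - F z.
  exact: (cF (Itv01 t0 t1) x z Dx Dz).
have tE : t * (z - x) = z - y by rewrite /t divfK // gt_eqF.
have yE : t * x + (1 - t) * z = y.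
  by rewrite -(subKr z y) -tE; ring.
rewrite yE !mulrN -opprD lerN2 -subr_ge0 in h.
have : 0 <= (F y - (t * F x + (1 - t) * F z)) * (z - x).
  by rewrite mulr_ge0 // ltW.
have -> : (F y - (t * F x + (1 - t) * F z)) * (z - x) =
  F y * (z - x) - ((t * (z - x)) * F x + (z - x - t * (z - x)) * F z) by ring.
rewrite tE; lra.
Qed.

(** The witness is the right derivative, taken as the supremum of the forward slopes. At 0 these may
    be unbounded, as for a square root, hence [0 < x] in the upper bound. *)
Lemma concave_derivative (R : realType) (F : R -> R) :
  concave_function halfline F ->
  exists f : R -> R,
    (forall x y, 0 <= x -> x < y -> f y * (y - x) <= F y - F x) /\
    (forall x y, 0 < x -> x < y -> F y - F x <= f x * (y - x)).
Proof.
move=> cF.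
pose S x := [set (F y - F x) / (y - x) | y in [set y | x < y]].
have S0 x : S x !=set0 by exists ((F (x + 1) - F x) / (x + 1 - x)), (x + 1) => //=; lra.
have ubS x y : 0 <= x -> x < y -> ubound (S y) ((F y - F x) / (y - x)).
  move=> x0 xy _ [z/= yz <-].
  rewrite ler_pdivrMr ?subr_gt0 // mulrAC ler_pdivlMr ?subr_gt0 //.
  exact: concave_slope.
exists (fun x => sup (S x)); split=> x y x0 xy.
  by rewrite -ler_pdivlMr ?subr_gt0 //; apply: ge_sup => //; exact: ubS.
rewrite -ler_pdivrMr ?subr_gt0 //; apply: ub_le_sup; last by exists y.
(* A slope arriving at [x] from the left bounds all forward slopes; the left point 0 is available
   since [0 < x]. *)
by exists ((F x - F 0) / (x - 0)); apply: ubS.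
Qed.

(* Each bisection of [x, y] halves the bound, since [g] telescopes. *)
Lemma monotone_osc_const (R : realType) (D g : R -> R) (a b : R) :
  (forall x y, a <= x -> x < y -> y <= b ->
    `|D y - D x| <= (g x - g y) * (y - x)) ->
  a < b -> D b = D a.
Proof.
move=> H ab.
have key n x y : a <= x -> x < y -> y <= b ->
    `|D y - D x| * 2 ^+ n <= (g x - g y) * (y - x).
  elim: n x y => [|n IH] x y ax xy yb; first by rewrite expr0 mulr1 H.
  have h1 := IH x ((x + y) / 2) ltac:(lra) ltac:(lra) ltac:(lra).
  have h2 := IH ((x + y) / 2) y ltac:(lra) ltac:(lra) ltac:(lra).
  set m := (x + y) / 2 in h1 h2.
  have h3 : `|D y - D x| <= `|D y - D m| + `|D m - D x|.
    by rewrite (le_trans _ (ler_normD _ _)) // addrA subrK.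
  have : `|D y - D x| * 2 ^+ n <= (`|D y - D m| + `|D m - D x|) * 2 ^+ n.
    by rewrite ler_pM2r // exprn_gt0.
  have mE : m = (x + y) / 2 by [].
  rewrite exprS; move: h1 h2; rewrite mE; lra.
apply/eqP; rewrite -subr_eq0 -normr_le0; apply/negP => /negP; rewrite -ltNge => d0.
have gab : 0 <= (g a - g b) * (b - a) by rewrite (le_trans (normr_ge0 _) (H _ _ _ _ _)).
set C := (g a - g b) * (b - a) in gab.
(* [key] bounds [|D b - D a| * 2 ^+ n] by [C] for every [n]; an integer above [C / |D b - D a|]
   contradicts this, as n < 2^n. *)
pose n := Num.bound (C / `|D b - D a|).
have hn : C / `|D b - D a| < n%:R.
  by apply: archi_boundP; rewrite divr_ge0 // ltW.
have := key n a b (lexx _) ab (lexx _); rewrite -/C leNgt => /negP; apply.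
rewrite ltr_pdivrMr // in hn; apply: (lt_le_trans hn).
by rewrite mulrC ler_pM2l // -natrX ler_nat ltnW // ltn_expl.
Qed.

(** * Uniqueness of a measure squeezed by a density *)

Section sandwich.
Context {R : realType}.
Implicit Types (m : {measure set (measurableTypeR R) -> \bar R}) (f : R -> R).

(** These are the bounds that a nonincreasing density [f] would force. They stand in for having
    density [f], so that absolute continuity need not be proved. *)
Definition sandwiched m f (x y : R) :=
  ((f y * (y - x))%:E <= m `]x, y]%classic <= (f x * (y - x))%:E)%E.

(** Both masses of []x, y]] lie in one window of width [(f x - f y) * (y - x)]. So the difference
    [D] of the two distribution functions satisfies [monotone_osc_const] with [g := f], and
    [D a = 0]. *)
Lemma sandwiched_itv_eq m1 m2 f (a b : R) :
  (forall x y, a <= x -> x < y -> y <= b -> sandwiched m1 f x y) ->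
  (forall x y, a <= x -> x < y -> y <= b -> sandwiched m2 f x y) ->
  a < b -> m1 `]a, b]%classic = m2 `]a, b]%classic.
Proof.
move=> h1 h2 ab.
have fin m x y : (forall x y, a <= x -> x < y -> y <= b -> sandwiched m f x y) ->
    a <= x -> x <= y -> y <= b -> m `]x, y]%classic \is a fin_num.
  move=> h ax xy yb; have [->|nxy] := eqVneq x y; first by rewrite set_itvoc0 measure0.
  have /andP[_ u] := h _ _ ax (ltac:(by rewrite lt_neqAle nxy) : x < y) yb.
  by rewrite ge0_fin_numE ?measure_ge0 // (le_lt_trans u) ?ltry.
have split m x y : (forall x y, a <= x -> x < y -> y <= b -> sandwiched m f x y) ->
    a <= x -> x < y -> y <= b ->
    fine (m `]a, y]%classic) - fine (m `]a, x]%classic) = fine (m `]x, y]%classic).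
  move=> h ax xy yb.
  have -> : `]a, y]%classic = `]a, x]%classic `|` `]x, y]%classic.
    by rewrite -itv_bndbnd_setU // bnd_simp // ltW.
  rewrite measureU //.
  - rewrite fineD; first by rewrite addrC addKr.
    + by apply: fin => //; lra.
    + by apply: fin => //; lra.
  - by apply/seteqP; split=> z //=; rewrite !in_itv/=; lra.
pose D z := fine (m1 `]a, z]%classic) - fine (m2 `]a, z]%classic).
have : D b = D a.
  apply: (@monotone_osc_const _ D f a b) => // x y ax xy yb.
  have -> : D y - D x = fine (m1 `]x, y]%classic) - fine (m2 `]x, y]%classic).
    by rewrite -(split _ _ _ h1) // -(split _ _ _ h2) // /D; ring.
  have /andP[l1 u1] := h1 x y ax xy yb; have /andP[l2 u2] := h2 x y ax xy yb.
  have f1 := fin _ _ _ h1 ax (ltW xy) yb.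
  have f2 := fin _ _ _ h2 ax (ltW xy) yb.
  rewrite -(fineK f1) !lee_fin in l1 u1; rewrite -(fineK f2) !lee_fin in l2 u2.
  by rewrite ler_norml; apply/andP; split; lra.
rewrite /D set_itvoc0 !measure0 /= subrr => /eqP; rewrite subr_eq0 => /eqP e.
rewrite -(fineK (fin _ _ _ h1 (lexx a) (ltW ab) (lexx b))).
by rewrite -(fineK (fin _ _ _ h2 (lexx a) (ltW ab) (lexx b))) e.
Qed.

(** The half-open intervals form a generating family stable under intersection, so uniqueness of
    measures applies to the restrictions to []c, +oo[]. The upper sandwich bound makes the
    exhausting intervals []-k, k]] of finite mass. *)
Lemma sandwiched_measure_eq m1 m2 f (c : R) (A : set (measurableTypeR R)) :
  (forall x y, c <= x -> x < y -> sandwiched m1 f x y) ->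
  (forall x y, c <= x -> x < y -> sandwiched m2 f x y) ->
  measurable A -> A `<=` `]c, +oo[%classic -> m1 A = m2 A.
Proof.
move=> h1 h2 mA Ac.
have mc : measurable (`]c, +oo[%classic : set (measurableTypeR R)) by [].
have IE (a b : R) : `]a, b]%classic `&` `]c, +oo[%classic
    = `](Num.max a c), b]%classic :> set R.
  by apply/seteqP; split=> z /=; rewrite !in_itv/= andbT gt_max;
    [case=> /andP[-> ->] -> | move=> /andP[/andP[-> ->] ->]].
suff H : forall A, measurable A -> mrestr m1 mc A = mrestr m2 mc A.
  by have := H A mA; rewrite /mrestr !setIidl.
apply: (@g_sigma_algebra_measure_unique _ R (measurableTypeR R) (@ocitv R) _
  (fun k : nat => `](- k%:R)%R, k%:R]%classic)) => //.
- by move=> B [[a b]] _ <-.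
- by move=> k; exists (- k%:R, k%:R).
- exact: bigcup_itvT.
- exact: ocitvI.
- move=> B [[a b] _ <-]; rewrite /= /mrestr !IE.
  have [ab|ab] := ltP (Num.max a c) b; last first.
    by rewrite set_itv_ge ?measure0 // bnd_simp -leNgt.
  have ca : c <= Num.max a c by rewrite le_max lexx orbT.
  by apply: (@sandwiched_itv_eq _ _ f) => // x y hx *;
    [apply: h1|apply: h2] => //; exact: le_trans hx.
- move=> k; rewrite /= /mrestr IE.
  have [ab|ab] := ltP (Num.max (- k%:R) c) k%:R; last first.
    by rewrite set_itv_ge ?measure0 // bnd_simp -leNgt.
  have ca : c <= Num.max (- k%:R) c by rewrite le_max lexx orbT.
  have /andP[_ u] := h1 _ _ ca ab.
  by rewrite (le_lt_trans u) ?ltry.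
Qed.

End sandwich.

(** * Measurability on the half-line and integrals over initial intervals *)

Lemma measurable_halfline (R : realType) :
  measurable (halfline : set (measurableTypeR R)).
Proof. exact: measurable_itv. Qed.

Lemma measurable_EFin_halfline (R : realType) (E : R -> R)
    (A : set (measurableTypeR R)) :
  measurable_fun halfline E -> A `<=` halfline ->
  measurable_fun A (fun x => (E x)%:E).
Proof.
move=> mE AE; apply/measurable_EFinP; apply: measurable_funS mE => //.
exact: measurable_halfline.
Qed.

(** Such a [D], when bounded and nonempty, is an interval from 0 to [sup D], and the bound defining
    [frakU] applies at [sup D]. An unbounded [D] is all of []0, +oo[], of infinite length. *)
Lemma frakU_integral_down (R : realType) (E : R -> R) (D : set (measurableTypeR R)) :
  frakU E -> measurable D -> D `<=` `]0, +oo[%classic ->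
  (forall x y, 0 < x -> x <= y -> D y -> D x) ->
  (\int[lebesgue_measure]_(x in D) (E x)%:E <= lebesgue_measure D)%E.
Proof.
move=> [[mE E0] _ hE] mD D0 down.
have [->|/set0P[d Dd]] := eqVneq D set0; first by rewrite integral_set0 measure0.
have d0 : 0 < d by have := D0 _ Dd; rewrite /= in_itv/= andbT.
have [hub|/has_ubPn nub] := pselect (has_ubound D); last first.
  have -> : D = `]0, +oo[%classic.
    apply/seteqP; split=> // x; rewrite /= in_itv/= andbT => x0.
    by have [y Dy xy] := nub x; exact: (down x y x0 (ltW xy)).
  by rewrite lebesgue_measure_itv /= ltry leey.
have sD : has_sup D by split => //; exists d.
have s0 : 0 < sup D by rewrite (lt_le_trans d0) // ub_le_sup.
apply: (@le_trans _ _ (\int[lebesgue_measure]_(x in `[0%R, sup D]) (E x)%:E)%E).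
  apply: ge0_subset_integral => //.
  - apply: measurable_EFin_halfline mE _.
    by move=> x /=; rewrite /halfline /= !in_itv/= => /andP[->].
  - by move=> x /=; rewrite in_itv/= lee_fin => /andP[x0 _]; apply: E0;
      rewrite /halfline/= in_itv/= x0.
  - move=> x Dx; have := D0 _ Dx; rewrite /= !in_itv/= andbT => /ltW ->/=.
    exact: ub_le_sup.
apply: (le_trans (hE _ (ltW s0))).
(* Whether [sup D] belongs to [D] is immaterial: the open interval below it lies in [D] and already
   has length [sup D]. *)
rewrite -[X in (X <= _)%E](_ : lebesgue_measure (`]0, sup D[%classic : set R) = _).
  apply: le_measure; rewrite ?inE //= => x /=; rewrite in_itv/= => /andP[x0 xs].
  have [y Dy xy] := sup_adherent (ltac:(by rewrite subr_gt0) : 0 < sup D - x) sD.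
  by apply: (down x y x0 _ Dy); rewrite subKr in xy; exact: ltW.
by rewrite lebesgue_measure_itv/= lte_fin s0 sube0.
Qed.

(** * Layer integration over the region below a density *)

Section tail.
Context {R : realType}.
Local Notation leb := (@lebesgue_measure R).
Local Notation leb2 := (leb \x leb)%E.

(* Under [leb2], the region [hypograph f] below the density [f] has the measure
   with density [f] as its first marginal. *)
Definition hypograph (f : R -> R) : set (measurableTypeR R * measurableTypeR R) :=
  [set p | 0 <= p.2 < f p.1].

(* The value [c] off the hypograph is a dump: only subsets of ]c, +oo[ are ever
   pulled back, so the first marginal needs no restricted measure. *)
Definition hypograph_fst (f : R -> R) (c : R)
    (p : measurableTypeR R * measurableTypeR R) : measurableTypeR R :=
  if 0 <= p.2 < f p.1 then p.1 else c.

Lemma measurable_hypograph_test (f : R -> R) : nonincreasing_fun f ->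
  measurable_fun setT
    (fun p : measurableTypeR R * measurableTypeR R => 0 <= p.2 < f p.1).
Proof.
move=> nif; apply: measurable_and.
  by apply: measurable_fun_ler => //; exact: measurable_snd.
apply: measurable_fun_ltr; first exact: measurable_snd.
apply: (@measurableT_comp _ _ _ _ _ _ f); last exact: measurable_fst.
exact: nonincreasing_measurable.
Qed.

Lemma measurable_hypograph (f : R -> R) : nonincreasing_fun f ->
  measurable (hypograph f).
Proof.
move=> /measurable_hypograph_test mf.
by rewrite -[hypograph f]setTI; exact: (mf measurableT [set true]).
Qed.

(** The cut [a] is [c] where [E] is integrated, and 0 where the horizontal slices must start at 0
    for [frakU_integral_down] to apply. *)
Definition hypograph_right (f : R -> R) (a : R) :
    set (measurableTypeR R * measurableTypeR R) :=
  hypograph f `&` (`]a, +oo[ `*` setT).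

Lemma measurable_hypograph_right (f : R -> R) a : nonincreasing_fun f ->
  measurable (hypograph_right f a).
Proof.
move=> nif.
by apply: measurableI; [exact: measurable_hypograph | exact: measurableX].
Qed.

Lemma measurable_hypograph_fst (f : R -> R) c : nonincreasing_fun f ->
  measurable_fun setT (hypograph_fst f c).
Proof.
move=> nif; apply: measurable_fun_ifT => //; exact: measurable_hypograph_test.
Qed.

Lemma hypograph_fst_preimage (f : R -> R) c (A : set (measurableTypeR R)) :
  A `<=` `]c, +oo[%classic ->
  hypograph_fst f c @^-1` A = hypograph f `&` (A `*` setT).
Proof.
move=> Ac; apply/seteqP; split=> -[x s]; rewrite /hypograph_fst /hypograph /=.
  by case: ifPn => // _ /Ac /=; rewrite in_itv/= ltxx.
by move=> [-> []].
Qed.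

Lemma leb2_rect (a b d : R) : a <= b -> 0 <= d ->
  leb2 (`]a, b]%classic `*` `[0, d[%classic) = (d * (b - a))%:E.
Proof.
move=> ab d0; rewrite product_measure1E //=.
rewrite !lebesgue_measure_itv /= !lte_fin sube0.
have [ab'|ab'] := ltP a b; last first.
  by have -> : a = b by [lra]; rewrite subrr mulr0 mul0e.
have [d0'|d0'] := ltP 0 d; last by have -> : d = 0 by [lra]; rewrite mul0r mule0.
by rewrite -EFinB -EFinM mulrC.
Qed.

(** Over []x, y]] the hypograph contains the rectangle of height [f y] and is contained in the one
    of height [f x]. *)
Lemma sandwiched_hypograph (f : R -> R) c (x y : R) : nonincreasing_fun f ->
  (forall z, 0 <= f z) -> c <= x -> x < y ->
  ((f y * (y - x))%:E <= leb2 (hypograph_fst f c @^-1` `]x, y]%classic)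
    <= (f x * (y - x))%:E)%E.
Proof.
move=> nif f0 cx xy.
have sub : `]x, y]%classic `<=` (`]c, +oo[%classic : set (measurableTypeR R)).
  by move=> z /=; rewrite !in_itv/= andbT => /andP[xz _]; exact: le_lt_trans xz.
have mH : measurable (hypograph f `&` (`]x, y]%classic `*` setT)).
  by apply: measurableI; [exact: measurable_hypograph | exact: measurableX].
rewrite hypograph_fst_preimage // -!leb2_rect // ?(ltW xy) //.
have mR d : measurable (`]x, y]%classic `*` `[0, d[%classic :
    set (measurableTypeR R * measurableTypeR R)) by exact: measurableX.
apply/andP; split; apply: le_measure; rewrite ?inE //= => -[z s] /=.
  rewrite /hypograph /= !in_itv/= => -[/andP[xz zy] /andP[s0 sf]].
  by rewrite s0 xz zy (lt_le_trans sf) // nif.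
rewrite /hypograph /= !in_itv/= => -[/andP[s0 sf] [/andP[xz zy] _]].
by rewrite s0 xz zy (lt_le_trans sf) // nif // ltW.
Qed.

(** By Tonelli, integrate along horizontal slices first. Widening the slice at height [s] from
    [x > c] to [x > 0] makes it downward closed, so the integral of [E] over it is at most its
    length; integrating the lengths over [s] gives the area. *)
Lemma frakU_integral_hypograph (E f : R -> R) c : frakU E -> 0 < c ->
  nonincreasing_fun f ->
  (\int[leb2]_(p in hypograph_right f c) (E p.1)%:E <=
   leb2 (hypograph_right f 0%R))%E.
Proof.
move=> UE c0 nif.
have [[mE E0] _ _] := UE.
have mX a := measurable_hypograph_right f a nif.
have cy : `]c, +oo[%classic `<=` (halfline : set R).
  by move=> x; rewrite /halfline /= !in_itv/= !andbT => /ltW; apply: le_trans; exact: ltW.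
rewrite integral_mkcond /=.
set g := (_ \_ _).
have mg : measurable_fun setT g.
  apply/(measurable_restrictT _ (mX c)) => /=.
  apply: (measurable_comp (F := `]c, +oo[%classic) (f := fun x => (E x)%:E)
    (g := fst)) => //.
  - by move=> _ /= [p [_ [pc _]] <-].
  - exact: measurable_EFin_halfline.
  - by apply: measurable_funTS; exact: measurable_fst.
have g0 z : (0 <= g z)%E.
  rewrite /g patchE; case: ifPn => // /[!inE] -[_ [/cy zc _]].
  by rewrite lee_fin E0.
rewrite fubini_tonelli2 //.
have mI : measurable_fun setT
    (fun z => (\1_(hypograph_right f 0%R) z : R)%:E).
  by apply/measurable_EFinP; exact: measurable_indic.
have I0 z : (0 <= (\1_(hypograph_right f 0%R) z : R)%:E)%E.
  by rewrite lee_fin.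
rewrite -(setIT (hypograph_right f 0%R)) -integral_indic // fubini_tonelli2 //.
apply: ge0_le_integral => //.
- by move=> s _; exact: integral_ge0.
- exact: measurable_fun_fubini_tonelli_G.
- exact: measurable_fun_fubini_tonelli_G.
move=> s _; rewrite /fubini_G /=.
pose D a := ysection (hypograph_right f a) s.
have mD a : measurable (D a) by exact: measurable_ysection.
have DE a x : D a x = (0 <= s < f x /\ a < x).
  by rewrite /D /ysection /= inE /hypograph_right /hypograph /= in_itv/= andbT; apply/propext; tauto.
have -> : (\int[leb]_x (\1_(hypograph_right f 0%R) (x, s) : R)%:E)%E
    = leb (D 0).
  rewrite -(setIT (D 0)) -integral_indic //; apply: eq_integral => x _.
  by rewrite !indicE /D mem_ysection.
apply: le_trans (frakU_integral_down R E (D 0) UE (mD 0) _ _); last 2 first.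
- by move=> x; rewrite DE /= in_itv/= => -[_ ->].
- move=> x y x0 xy; rewrite !DE x0 => -[/andP[-> sf] _]; split=> //=.
  by rewrite (lt_le_trans sf) // nif.
rewrite [leLHS](_ : _ = \int[leb]_(x in D c) (E x)%:E)%E.
  apply: ge0_subset_integral => //.
  - apply: measurable_EFin_halfline => // x; rewrite DE => -[_ x0].
    by rewrite /halfline/= in_itv/= ltW.
  - move=> x; rewrite DE => -[_ x0].
    by rewrite lee_fin E0 // /halfline/= in_itv/= ltW.
  - by move=> x; rewrite !DE => -[-> /(lt_trans c0)].
rewrite [RHS]integral_mkcond; apply: eq_integral => x _.
by rewrite /g !patchE /D mem_ysection.
Qed.

(** On []c, +oo[], [P] is the first marginal of area on the hypograph. The term [f c * c] is the
    price of starting the slices at 0: with [f] constant to the left of [c], it is the area added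
    over []0, c]]. *)
Lemma frakU_integral_tail (P : {measure set (measurableTypeR R) -> \bar R})
    (E f : R -> R) c :
  frakU E -> 0 < c -> nonincreasing_fun f -> (forall x, 0 <= f x) ->
  (forall x, x <= c -> f x = f c) ->
  (forall x y, c <= x -> x < y -> sandwiched P f x y) ->
  (\int[P]_(x in `]c, +oo[) (E x)%:E <= (f c * c)%:E + P `]c, +oo[%classic)%E.
Proof.
move=> UE c0 nif f0 fc hP.
have [[mE E0] _ _] := UE.
have mphi := measurable_hypograph_fst f c nif.
pose Q := pushforward leb2 (hypograph_fst f c).
have cy : `]c, +oo[%classic `<=` (halfline : set R).
  by move=> x; rewrite /halfline /= !in_itv/= !andbT => /ltW; apply: le_trans; exact: ltW.
have PQ A : measurable A -> A `<=` `]c, +oo[%classic -> P A = Q A.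
  apply: (sandwiched_measure_eq P (pushforward leb2 (hypograph_fst f c))) hP _.
  by move=> x y cx xy; exact: sandwiched_hypograph.
rewrite (eq_measure_integral (pushforward leb2 (hypograph_fst f c))) // ge0_integral_pushforward //; last 2 first.
- exact: measurable_EFin_halfline.
- by move=> y /[!inE] /cy yc; rewrite lee_fin E0.
rewrite PQ // /Q /pushforward hypograph_fst_preimage //.
rewrite -/(hypograph_right f c).
rewrite [leLHS](_ : _ = \int[leb2]_(p in hypograph_right f c) (E p.1)%:E)%E; last first.
  apply: eq_integral => -[x s]; rewrite inE.
  by rewrite /hypograph_right /hypograph /hypograph_fst /= => -[-> _].
apply: (le_trans (frakU_integral_hypograph _ _ _ UE c0 nif)).
have mX a := measurable_hypograph_right f a nif.
have -> : f c * c = f c * (c - 0) by rewrite subr0.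
rewrite -leb2_rect // ?(ltW c0) //.
set rect := (_ `*` _).
have mrect : measurable rect by exact: measurableX.
(* The region over []0, +oo[] is covered by the rectangle over []0, c]] and the region over []c,
   +oo[]; subadditivity suffices. *)
apply: (@le_trans _ _ (leb2 (rect `|` hypograph_right f c))); last exact: measureU2.
apply: le_measure; rewrite ?inE //; first exact: measurableU.
move=> [x s]; rewrite /hypograph_right /hypograph /= !in_itv/= !andbT => -[/andP[s0 sf] [x0 _]].
have [xc|cx] := leP x c; last by right; rewrite s0 sf.
by left; rewrite /rect /= !in_itv/= x0 xc s0 -(fc x xc).
Qed.

End tail.

(** * Laws with a concave distribution function *)

Lemma dist_funB (R : realType) (P : probability (measurableTypeR R) R) (x y : R) :
  x <= y -> P `]x, y]%classic = (dist_fun P y - dist_fun P x)%:E.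
Proof.
move=> xy; rewrite /dist_fun.
have -> : `]-oo, y]%classic = `]-oo, x]%classic `|` `]x, y]%classic :> set R.
  by rewrite -itv_bndbnd_setU // bnd_simp.
rewrite measureU //; last first.
  by apply/seteqP; split=> z //=; rewrite !in_itv/=; lra.
by rewrite fineD ?fin_num_measure // addrC addKr fineK // fin_num_measure.
Qed.

(** The density may blow up at 0, so it is first frozen at the value [f c] to the left of some
    [c > 0], and then [c] tends to 0. *)
Lemma frakU_integral_pos (R : realType) (P : probability (measurableTypeR R) R)
    (E : R -> R) :
  concave_function halfline (dist_fun P) -> frakU E ->
  (\int[P]_(x in `]0%R, +oo[) (E x)%:E <= P `]0%R, +oo[%classic)%E.
Proof.
move=> cF UE; have [[mE E0] _ _] := UE.
have pos_half : `]0%R, +oo[%classic `<=` (halfline : set R).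
  by move=> x; rewrite /halfline /= !in_itv/= !andbT => /ltW.
have [f [fl fu]] := concave_derivative _ _ cF.
have f0 x : 0 < x -> 0 <= f x.
  move=> x0; have x1 : x < x + 1 by lra.
  have := fu _ _ x0 x1; rewrite -lee_fin -dist_funB ?(ltW x1) // => /(le_trans (measure_ge0 _ _)).
  by rewrite lee_fin addrAC subrr add0r mulr1.
have ni x y : 0 < x -> x <= y -> f y <= f x.
  rewrite le_eqVlt => x0 /predU1P[->//|xy].
  by have := le_trans (fl _ _ (ltW x0) xy) (fu _ _ x0 xy); rewrite ler_pM2r ?subr_gt0.
have tail c : 0 < c ->
    (\int[P]_(x in `]c, +oo[) (E x)%:E <= P `]0%R, +oo[%classic)%E.
  move=> c0; have pmax x : 0 < Num.max x c by rewrite lt_max c0 orbT.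
  apply: (le_trans (frakU_integral_tail P E (fun x => f (Num.max x c)) c UE c0 _ _ _ _)).
  - by move=> x y xy; apply: ni => //; rewrite ge_max !le_max xy lexx /= orbT.
  - by move=> x; exact: f0.
  - by move=> x xc; rewrite maxxx max_r.
  - move=> x y cx xy; rewrite /sandwiched /= dist_funB ?(ltW xy) // !lee_fin.
    have x0 : 0 < x by exact: lt_le_trans cx.
    rewrite !max_l // ?fl ?fu // ?(ltW x0) //.
    by rewrite (le_trans cx) // ltW.
  have -> : `]0, +oo[%classic = `]0, c]%classic `|` `]c, +oo[%classic :> set R.
    by rewrite -itv_bndbnd_setU // bnd_simp // ltW.
  rewrite measureU //; last by apply/seteqP; split=> z //=; rewrite !in_itv/= andbT; lra.
  (* Concavity pays for the rectangle: the lower slope bound on []0, c]] says that [f c * c] is at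
     most the mass of []0, c]]. *)
  rewrite leeD2r //= dist_funB ?(ltW c0) // lee_fin maxxx.
  by have := fl _ _ (lexx 0) c0; rewrite subr0.
(* With [c = 1 / (n + 1)] the tails increase to []0, +oo[], and monotone convergence passes the
   uniform bound to the limit. *)
pose I (n : nat) : set (measurableTypeR R) := `]n.+1%:R^-1, +oo[%classic.
have II : \bigcup_n I n = `]0, +oo[%classic.
  apply/seteqP; split=> x /=.
    by move=> [n _] /=; rewrite /I /= !in_itv/= !andbT; apply: lt_trans; rewrite invr_gt0.
  rewrite in_itv/= andbT => x0; exists (Num.truncn x^-1) => //=.
  rewrite /I /= in_itv/= andbT invf_plt ?posrE //.
  exact: truncnS_gt.
have sub n x : I n x -> halfline x.
  by move=> Ix; apply: pos_half; rewrite -II; exists n.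
have ndI : nondecreasing_seq I.
  move=> m n mn; apply/subsetPset => x; rewrite /I /= !in_itv/= !andbT.
  by apply: le_lt_trans; rewrite lef_pV2 ?posrE // ler_nat.
have mI n : measurable (I n) by exact: measurable_itv.
have mEI n : measurable_fun (I n) (fun x => (E x)%:E).
  by apply: measurable_EFin_halfline => // x; exact: sub.
have EI0 n x : I n x -> (0 <= (E x)%:E)%E by move=> /sub hx; rewrite lee_fin E0.
rewrite -II -(cvg_lim _ (ge0_nondecreasing_set_cvg_integral ndI mI mEI EI0)) // II.
apply: lime_le; last by apply: nearW => n; apply: tail; rewrite invr_gt0.
apply: ereal_nondecreasing_is_cvgn.
exact: ge0_nondecreasing_set_nondecreasing_integral.
Qed.

(** * Separating the atom at 0 *)

Lemma halflineE (R : realType) :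
  halfline = [set 0] `|` `]0, +oo[%classic :> set R.
Proof.
apply/seteqP; split=> x; rewrite /halfline /= !in_itv/= !andbT le_eqVlt.
  by case/predU1P => [<-|]; [left|right].
by case=> [->|->]; rewrite ?eqxx ?orbT.
Qed.

Lemma set0_pos_disjoint (R : realType) :
  [disjoint [set (0 : R)] & `]0, +oo[%classic].
Proof.
by apply/disj_setPS => x /= [->]; rewrite in_itv/= ltxx.
Qed.

Lemma halfline_integralE (R : realType) (P : probability (measurableTypeR R) R)
    (E : R -> R) : nonneg_measurable E ->
  (\int[P]_(x in halfline) (E x)%:E =
   (E 0)%:E * P [set 0%R] + \int[P]_(x in `]0%R, +oo[) (E x)%:E)%E.
Proof.
move=> [mE E0].
rewrite halflineE ge0_integral_setU //.
- congr (_ + _)%E; rewrite -integral_cst //.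
  by apply: eq_integral => x; rewrite inE /= => ->.
- by rewrite -halflineE; exact: measurable_EFin_halfline.
- by move=> x; rewrite -halflineE lee_fin => /E0.
- exact: set0_pos_disjoint.
Qed.

Lemma halfline_probabilityE (R : realType) (P : probability (measurableTypeR R) R) :
  halfline_probability P -> (P [set 0%R] + P `]0%R, +oo[%classic = 1)%E.
Proof.
rewrite /halfline_probability /= halflineE measureU //.
by apply/disj_set2P; exact: set0_pos_disjoint.
Qed.

(** * Uniform and Dirac test laws *)

Lemma dist_fun_uniform (R : realType) (x z : R) (x0 : 0 < x) : 0 <= z ->
  dist_fun (uniform_prob x0) z = Num.min z x / x.
Proof.
move=> z0; rewrite /dist_fun /= /uniform_prob integral_uniform_pdf.
have -> : `]-oo, z]%classic `&` `[0, x]%classic = `[0, Num.min z x]%classic :> set R.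
  by apply/seteqP; split=> y /=; rewrite !in_itv/= le_min;
    [case=> -> /andP[-> ->] | case/and3P => -> -> ->].
rewrite (eq_integral (fun=> x^-1%:E)); last first.
  move=> y; rewrite inE/= in_itv/= le_min => /and3P[y0 _ yx].
  by rewrite /uniform_pdf y0 yx subr0.
rewrite integral_cst //= lebesgue_measure_itv /= lte_fin.
have [m0|m0] := ltP 0 (Num.min z x); first by rewrite /= oppr0 addr0 mulrC.
have -> : Num.min z x = 0 by apply/eqP; rewrite eq_le m0 le_min z0 ltW.
by rewrite mule0 mul0r.
Qed.

Lemma concave_halflineI (R : realType) (F : R -> R) :
  (forall t a b, 0 <= t -> t <= 1 -> 0 <= a -> 0 <= b ->
    t * F a + (1 - t) * F b <= F (t * a + (1 - t) * b)) ->
  concave_function halfline F.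
Proof.
move=> cF [t tP] a b; rewrite !inE /halfline /= !in_itv/= !andbT => a0 b0.
have [t0 t1] : 0 <= t /\ t <= 1.
  by move: tP; rewrite /Itv.spec /= /Itv.num_sem in_itv/= => /and3P[_ -> ->].
suff : - F (t * a + (1 - t) * b) <= t * - F a + (1 - t) * - F b by [].
by rewrite !mulrN -opprD lerN2 cF.
Qed.

Lemma concave_min_div (R : realType) (x : R) (F : R -> R) : 0 < x ->
  (forall z, 0 <= z -> F z = Num.min z x / x) -> concave_function halfline F.
Proof.
move=> x0 FE; apply: concave_halflineI => t a b t0 t1 a0 b0.
have t1' : 0 <= 1 - t by rewrite subr_ge0.
rewrite !FE // ?addr_ge0 ?mulr_ge0 // !mulrA -mulrDl.
rewrite ler_pM2r ?invr_gt0 // le_min; apply/andP; split.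
  by rewrite lerD // ler_wpM2l // ge_min lexx.
(* The constant [x] is written as its own convex combination, to compare term by term. *)
have {3}-> : x = t * x + (1 - t) * x by ring.
by rewrite lerD // ler_wpM2l // ge_min lexx orbT.
Qed.

Lemma uniform_U00plus (R : realType) (x : R) (x0 : 0 < x) :
  U00plus (uniform_prob x0 : probability (measurableTypeR R) R).
Proof.
split; last first.
  by rewrite /= /uniform_prob integral_set1.
split; last exact: (concave_min_div _ _ _ x0 (fun z => dist_fun_uniform R x z x0)).
rewrite /halfline_probability /= /uniform_prob integral_uniform_pdf1 //.
by move=> y; rewrite /halfline /= !in_itv/= => /andP[->].
Qed.

Lemma dirac_U0plus (R : realType) :
  U0plus (\d_(0 : measurableTypeR R) : probability (measurableTypeR R) R).
Proof.
split; first by rewrite /halfline_probability /= diracE mem_set // /halfline /= in_itv/= lexx.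
have FE z : 0 <= z -> dist_fun (\d_(0 : measurableTypeR R)) z = 1.
  move=> z0; apply: (congr1 fine (_ : dirac (0 : R) `]-oo, z]%classic = 1%E)).
  by rewrite diracE mem_set //= in_itv/= z0.
apply: concave_halflineI => t a b t0 t1 a0 b0.
have t1' : 0 <= 1 - t by rewrite subr_ge0.
by rewrite !FE // ?addr_ge0 ?mulr_ge0 // !mulr1 subrKC.
Qed.

Lemma integral_uniform_halfline (R : realType) (E : R -> R) (x : R) (x0 : 0 < x) :
  nonneg_measurable E ->
  (\int[uniform_prob x0]_(t in halfline) (E t)%:E =
   x^-1%:E * \int[lebesgue_measure]_(t in `[0%R, x]) (E t)%:E)%E.
Proof.
move=> [mE E0].
(* [E] is measurable on the half-line only, so it is first extended by 0. *)
rewrite integral_mkcond integral_uniform.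
- rewrite subr0; congr (_ * _)%E; apply: eq_integral => t.
  rewrite inE /= in_itv/= => /andP[t0 _].
  by rewrite patchE mem_set // /halfline /= in_itv/= t0.
- by apply/(measurable_restrictT _ (measurable_halfline R)); exact: measurable_EFin_halfline.
- by move=> t; rewrite patchE; case: ifPn => // /[!inE] /E0; rewrite lee_fin.
Qed.

(** * The two polars *)

(** Testing [E] against the uniform law on [[0, x]] gives the integral bound at [x]; local
    integrability follows, since a compact subset of the half-line lies in some [[0, N]]. *)
Lemma polar_U00plus_sub (R : realType) : polar (@U00plus R) `<=` frakU.
Proof.
move=> E [NE hE].
have bound x : 0 <= x ->
    (\int[lebesgue_measure]_(t in `[0%R, x]) (E t)%:E <= x%:E)%E.
  rewrite le_eqVlt => /predU1P[<-|x0]; first by rewrite set_itv1 integral_set1.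
  have := hE _ (uniform_U00plus R x x0).
  by rewrite integral_uniform_halfline // lee_pdivrMl // mule1.
have [mE E0] := NE.
split=> //; split=> // K KD cK.
have [M [_ MK]] := compact_bounded cK.
(* The maximum makes [N] nonnegative, as [bound] requires; the added 1 makes it strictly greater
   than [M], as [MK] requires. *)
pose N := Num.max 0 M + 1.
have N0 : 0 <= N by rewrite addr_ge0 // le_max lexx.
have KN : K `<=` `[0, N]%classic.
  move=> x Kx; have := KD _ Kx; rewrite /halfline /= !in_itv/= andbT => -> /=.
  apply: (le_trans (ler_norm x)); apply: MK => //.
  by rewrite /N (le_lt_trans (_ : M <= Num.max 0 M)) ?ltrDl // le_max lexx orbT.
have half : `[0, N]%classic `<=` (halfline : set R).
  by move=> x; rewrite /halfline /= !in_itv/= => /andP[->].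
rewrite [ltLHS](_ : _ = \int[lebesgue_measure]_(x in K) (E x)%:E)%E; last first.
  by apply: eq_integral => x /[!inE] /KD hx; rewrite ger0_norm // E0.
apply: le_lt_trans (ltry N); apply: le_trans (bound _ N0).
apply: ge0_subset_integral => //.
- exact: compact_measurable.
- exact: measurable_EFin_halfline.
- by move=> x /half hx; rewrite lee_fin E0.
Qed.

(** Shared by both polars: they differ only in why the atom contributes at most its mass, namely [P
    [set 0] = 0] for one and [E 0 <= 1] for the other. *)
Lemma frakU_integral_le1 (R : realType) (P : probability (measurableTypeR R) R)
    (E : R -> R) :
  U0plus P -> frakU E -> ((E 0)%:E * P [set 0%R] <= P [set 0%R])%E ->
  (\int[P]_(x in halfline) (E x)%:E <= 1)%E.
Proof.
move=> [hP cF] UE h0; have [NE _ _] := UE.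
rewrite halfline_integralE // -(halfline_probabilityE _ _ hP).
by apply: leeD => //; exact: frakU_integral_pos.
Qed.

Theorem theorem4p9 (R : realType) :
  polar (@U00plus R) = @frakU R /\ polar (@U0plus R) = @frakU1 R.
Proof.
split; apply/seteqP; split.
- exact: polar_U00plus_sub.
- move=> E UE; have [NE _ _] := UE; split=> // P [UP P0].
  by apply: frakU_integral_le1 => //; rewrite P0 mule0.
- move=> E [NE hE]; split.
    (* Polarity reverses the inclusion of [U00plus] in [U0plus]. *)
    by apply: polar_U00plus_sub; split=> // P [UP _]; exact: hE.
  have := hE _ (dirac_U0plus R).
  rewrite integral_dirac //; last 2 first.
  - exact: measurable_halfline.
  - by apply: measurable_EFin_halfline => //; case: NE.
  by rewrite diracE mem_set ?mul1e ?lee_fin // /halfline /= in_itv/= lexx.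
- move=> E [UE E01]; have [NE _ _] := UE; split=> // P UP.
  apply: frakU_integral_le1 => //.
  by rewrite -[leRHS]mul1e lee_wpmul2r.
Qed.
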